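(* Let $m\in\mathbb{N}$, $m\ge 1$, let $\Pi\subseteq\Pi_m$ be a polynomial subspace, let $P\subseteq\mathbb{R}^m$ be a finite non-empty set, and let $H=Q_H^{-1}(0)$ be a hyperplane of co-dimension 1 defined by a polynomial $Q_H\in\Pi_{m,1,1}\setminus\{0\}$. Assume: (i) every affine transformation $\tau:\mathbb{R}^m\to\mathbb{R}^m$ with $\tau(H)=\mathbb{R}^{m-1}\times\{0\}$ is canonical with respect to $\Pi$; let $\tau_H$ be one fixed such transformation; (ii) $P$ is unisolvent with respect to $(\Pi,H)$ (defined using this $\tau_H$). Then $P$ is unisolvent with respect to $\Pi$.
   Context: $\Pi_m$ is the real vector space of all real polynomials in $x_1,\dots,x_m$; $\Pi_{m,1,1}$ is the space of polynomials of total degree at most $1$. A polynomial subspace is a linear subspace of $\Pi_m$. An affine transformation is a map $\tau(x)=Bx+b$ with $B\in\mathbb{R}^{m\times m}$ invertible and $b\in\mathbb{R}^m$. It induces $\tau^*:\Pi_m\to\Pi_m$, $\tau^*(Q)(x)=Q(\tau(x))$. It is called canonical with respect to $\Pi$ if $\tau^*(\Pi)\subseteq\Pi$. A finite non-empty set $P\subseteq\mathbb{R}^m$ is unisolvent with respect to $\Pi$ if there is no $Q\in\Pi\setminus\{0\}$ with $Q(p)=0$ for all $p\in P$. Let $H=Q_H^{-1}(0)$ be a hyperplane as in (i) and $\tau_H$ an affine transformation with $\tau_H(H)=\mathbb{R}^{m-1}\times\{0\}$. Let $\Pi_{m-1}\times\{0\}\subseteq\Pi_m$ denote the polynomials that do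 not depend on $x_m$. Set $$\Pi_{|H}=\{Q\in\Pi : \tau_H^*(Q)\in\Pi\cap(\Pi_{m-1}\times\{0\})\},\qquad \Pi_{|H}^\perp=\{Q\in\Pi_m : Q_HQ\in\Pi\}.$$ The finite non-empty set $P$ is unisolvent with respect to $(\Pi,H)$ if both of the following hold: (a) there is no $Q\in\Pi_{|H}$ with $\tau_H^*(Q)\neq 0$ and $Q(p)=0$ for all $p\in P\cap H$; (b) there is no $Q\in\Pi_{|H}^\perp\setminus\{0\}$ with $Q(p)=0$ for all $p\in P\setminus H$. *)

(* Defs.v *)
From HB Require Import structures.
From mathcomp Require Import all_boot all_order all_algebra.
From mathcomp Require Import boolp classical_sets functions cardinality reals.
From mathcomp Require Import mpoly.

Set Implicit Arguments.
Unset Strict Implicit.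
Unset Printing Implicit Defensive.

Import Order.TTheory GRing.Theory Num.Theory.

Local Open Scope classical_set_scope.
Local Open Scope ring_scope.

Definition evalp (R : realType) (m : nat) (Q : {mpoly R[m]}) (x : 'cV[R]_m) : R :=
  Q.@[fun i => x i 0].

Definition zero_set (R : realType) (m : nat) (Q : {mpoly R[m]}) : set 'cV[R]_m :=
  [set x | evalp Q x = 0].

Definition polynomial_subspace (R : realType) (m : nat)
    (Pi : set {mpoly R[m]}) : Prop :=
  submod_closed (mem Pi).

(* [msize Q] is the total degree of [Q] plus one, and [msize 0 = 0]. *)
Definition degree_le1 (R : realType) (m : nat) : set {mpoly R[m]} :=
  [set Q | (msize Q <= 2)%N].

Definition is_hyperplane (R : realType) (m : nat) (H : set 'cV[R]_m) : Prop :=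
  exists (a : 'rV[R]_m) (c : R),
    a != 0 /\ H = [set x | (a *m x) 0 0 = c].

Record affine_transformation (R : realType) (m : nat) := AffineTransformation {
  aff_lin : 'M[R]_m;
  aff_shift : 'cV[R]_m;
  aff_lin_unit : aff_lin \in unitmx
}.

Definition aff_apply (R : realType) (m : nat) (tau : affine_transformation R m)
    (x : 'cV[R]_m) : 'cV[R]_m :=
  aff_lin tau *m x + aff_shift tau.

Coercion aff_apply : affine_transformation >-> Funclass.

(* The i-th coordinate of [tau x], as a polynomial in the coordinates of [x],
   is substituted for the i-th variable. *)
Definition pullback (R : realType) (m : nat) (tau : affine_transformation R m)
    (Q : {mpoly R[m]}) : {mpoly R[m]} :=
  Q \mPo [tuple \sum_(j < m) aff_lin tau i j *: 'X_j + (aff_shift tau i 0)%:MP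
         | i < m].

Lemma evalp_pullback (R : realType) (m : nat) (tau : affine_transformation R m)
    (Q : {mpoly R[m]}) (x : 'cV[R]_m) :
  evalp (pullback tau Q) x = evalp Q (tau x).
Proof.
rewrite /evalp /pullback comp_mpoly_meval; apply: meval_eq.
move=> i; rewrite tnth_mktuple mevalD mevalC !mxE; congr (_ + _).
rewrite raddf_sum /=; apply: eq_bigr => j _.
by rewrite mevalZ mevalXU.
Qed.

Definition canonical_for (R : realType) (m : nat) (Pi : set {mpoly R[m]})
    (tau : affine_transformation R m) : Prop :=
  pullback tau @` Pi `<=` Pi.

Definition unisolvent (R : realType) (m : nat) (Pi : set {mpoly R[m]})
    (P : set 'cV[R]_m) : Prop :=
  ~ exists Q, [/\ Pi Q, Q != 0 & forall p, P p -> evalp Q p = 0].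

(* With n.+1 variables there is always a last coordinate,
   of index [ord_max]. *)

Definition last_zero (R : realType) (n : nat) : set 'cV[R]_n.+1 :=
  [set x | x ord_max 0 = 0].

(* [mwiden] sends each of the first n variables to the variable of the same
   index, so its range is the space of polynomials free of the last variable. *)
Definition no_last_var (R : realType) (n : nat) : set {mpoly R[n.+1]} :=
  range (@mwiden n R).

Definition restr_space (R : realType) (n : nat) (Pi : set {mpoly R[n.+1]})
    (tauH : affine_transformation R n.+1) : set {mpoly R[n.+1]} :=
  [set Q | Pi Q /\ (Pi `&` @no_last_var R n) (pullback tauH Q)].

Definition perp_space (R : realType) (m : nat) (Pi : set {mpoly R[m]})
    (QH : {mpoly R[m]}) : set {mpoly R[m]} :=
  [set Q | Pi (QH * Q)].

Definition unisolvent_rel (R : realType) (n : nat) (Pi : set {mpoly R[n.+1]})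
    (H : set 'cV[R]_n.+1) (QH : {mpoly R[n.+1]})
    (tauH : affine_transformation R n.+1) (P : set 'cV[R]_n.+1) : Prop :=
  (~ exists Q, [/\ restr_space Pi tauH Q, pullback tauH Q != 0
                 & forall p, (P `&` H) p -> evalp Q p = 0]) /\
  (~ exists Q, [/\ perp_space Pi QH Q, Q != 0
                 & forall p, (P `\` H) p -> evalp Q p = 0]).

(* Main.v *)
Require Import Defs.
From HB Require Import structures.
From mathcomp Require Import all_boot all_order all_algebra.
From mathcomp Require Import boolp classical_sets functions cardinality reals.
From mathcomp Require Import mpoly.

(* Write [T] for the pullback by [tauH], [v] for the image of the last basis
   vector under the linear part of [tauH], and [a] for the linear part of [QH].
   For small [s] the map [g x = x + s QH(x) w] is an affine bijection fixing
   [H] pointwise, so [tauH \o g] is again canonical. As [T] is onto [Pi] (it is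
   injective and does not raise degrees), [Q \o g] lies in [Pi] whenever [Q]
   does, and hence so does every coefficient [QH^k D_k] of its expansion in [s].

   Let [Q] in [Pi] vanish on [P]. If [a v <> 0], take [w = v] and the degenerate
   value [s = -1/(a v)]: then [g] is the projection onto [H] along [v], so
   [Q \o g] is in the restricted space and vanishes on the points of [P] in [H].
   Hence [Q \o g = 0], [QH] divides [Q], and the cofactor vanishes by (b).
   If [a v = 0], which the hypotheses do not exclude, a [w] outside the zero set
   of the leading form of [Q] gives [QH^d] in [Pi] with [d = deg Q > 0]; it is
   constant along [v] and vanishes on [H], contradicting (a). *)

Set Implicit Arguments.
Unset Strict Implicit.
Unset Printing Implicit Defensive.

Import Order.TTheory GRing.Theory Num.Theory.

Local Open Scope classical_set_scope.
Local Open Scope ring_scope.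

Local Notation widen := (widen_ord (leqnSn _)).

(** * Points where a nonzero polynomial does not vanish *)

Lemma poly_nonroot (R : numDomainType) (p : {poly R}) :
  p != 0 -> exists t, p.[t] != 0.
Proof.
move=> p0; pose s : seq R := [seq i%:R | i <- iota 0 (size p)].
have us : uniq s.
  by rewrite map_inj_uniq ?iota_uniq // => i j /eqP; rewrite eqr_nat => /eqP.
have : ~~ all (root p) s.
  apply/negP => /(max_poly_roots p0) /(_ us).
  by rewrite size_map size_iota ltnn.
by case/allPn => t _ pt; exists t.
Qed.

(** [muni] has a left inverse: widening the coefficients and substituting the last variable for the
    main one recovers [p]. *)
Lemma muni_eq0 (R : comNzRingType) n (p : {mpoly R[n.+1]}) :
  muni p = 0 -> p = 0.
Proof.
move=> p0.
have <- : (map_poly (@mwiden n R) (muni p)).['X_ord_max] = p; last first.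
  by rewrite p0 map_poly0 horner0.
rewrite muniE raddf_sum horner_sum [RHS]mpolyE; apply: eq_bigr => m _ /=.
rewrite -mul_polyC rmorphM /= map_polyC /= map_polyXn hornerCM hornerXn.
rewrite mwidenZ mwidenX -scalerAl; congr (_ *: _).
rewrite mpolyXn -mpolyXD; congr 'X_[_]; apply/mnmP => i.
rewrite mnmDE mulmnE mnm1E; case: (unliftP ord_max i) => [j|] ->.
  have -> : lift ord_max j = widen j.
    by apply/val_inj; rewrite /= /bump leqNgt ltn_ord.
  rewrite mnmwiden_widen mnmE.
  by rewrite (_ : _ == _ = false) ?addn0 // -val_eqE /= gtn_eqF.
by rewrite mnmwiden_ordmax eqxx mul1n.
Qed.

Lemma meval_muni (R : comNzRingType) n (p : {mpoly R[n.+1]}) (v : 'I_n.+1 -> R) :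
  p.@[v] = (map_poly (meval (fun i => v (widen i))) (muni p)).[v ord_max].
Proof.
rewrite muniE raddf_sum horner_sum mevalE; apply: eq_bigr => m _ /=.
rewrite -mul_polyC rmorphM /= map_polyC /= map_polyXn hornerCM hornerXn.
rewrite mevalZ mevalX -mulrA big_ord_recr /=; congr (_ * (_ * _)).
by apply: eq_bigr => i _; rewrite mnmE.
Qed.

(** Induction on the number of variables: at a point [v] where the leading coefficient in the last
    variable is nonzero, a nonzero univariate polynomial remains, and [t] is a non-root of it. *)
Lemma meval_neq0 (R : numDomainType) n (p : {mpoly R[n]}) :
  p != 0 -> exists v, p.@[v] != 0.
Proof.
elim: n p => [|n IH] p p0.
  exists (fun=> 0); rewrite [p]nvar0_mpolyC mevalC.
  by apply: contra_neq p0 => p00; rewrite [p]nvar0_mpolyC p00 mpolyC0.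
have /IH[v pv] : lead_coef (muni p) != 0.
  by rewrite lead_coef_eq0; apply: contra_neq p0; apply: muni_eq0.
have /poly_nonroot[t pt] : map_poly (meval v) (muni p) != 0.
  apply: contra_neq pv => /polyP/(_ (size (muni p)).-1).
  by rewrite coef_map coef0.
exists (fun i => if unlift ord_max i is Some j then v j else t).
rewrite meval_muni unlift_none; congr (_.[_] != 0): pt.
apply: eq_map_poly => q; apply: meval_eq => i.
have -> : widen i = lift ord_max i.
  by apply/val_inj; rewrite /= /bump leqNgt ltn_ord.
by rewrite liftK.
Qed.

(** * Subspaces given as sets, and extraction of coefficients *)

Section Submod.
Context (R : pzRingType) (V : lmodType R) (S : set V).
Hypothesis Ssub : submod_closed (mem S).

Lemma submod0 : S 0. Proof. by case: Ssub => /set_mem. Qed.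

Lemma submodZD c u v : S u -> S v -> S (c *: u + v).
Proof. by move=> /mem_set Su /mem_set Sv; apply/set_mem; apply: Ssub.2. Qed.

Lemma submodZ c u : S u -> S (c *: u).
Proof. by move=> Su; rewrite -[_ *: _]addr0; apply: submodZD submod0. Qed.

Lemma submodD u v : S u -> S v -> S (u + v).
Proof. by move=> Su Sv; rewrite -[u]scale1r; apply: submodZD. Qed.

Lemma submod_sum (I : Type) (r : seq I) (P : pred I) (F : I -> V) :
  (forall i, P i -> S (F i)) -> S (\sum_(i <- r | P i) F i).
Proof. by move=> SF; elim/big_ind: _ => //; [exact: submod0 | exact: submodD]. Qed.

End Submod.

(* [q(s/2) - 2^-N q(s)] eliminates the coefficient of degree [N]. *)
Lemma submod_coef (R : realFieldType) (V : lmodType R) (S : set V)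
    (Ssub : submod_closed (mem S)) (d : R) (N : nat) (u : nat -> V) :
  0 < d -> (forall s, 0 < s < d -> S (\sum_(k < N) s ^+ k *: u k)) ->
  forall k, (k < N)%N -> S (u k).
Proof.
move=> d0; elim: N u => // N IH u Su.
have SuN k : (k < N)%N -> S (u k).
  move=> kN; pose e j : R := 2^-1 ^+ j - 2^-1 ^+ N.
  have e_neq0 : e k != 0.
    rewrite subr_eq0 gt_eqF // ltr_iXn2l //.
      by rewrite invr_gt0 ltr0n.
    by rewrite invf_lt1 ?ltr1n ?ltr0n.
  suff : S (e k *: u k).
    by move/(submodZ Ssub (e k)^-1); rewrite scalerA mulVf // scale1r.
  apply: (IH (fun k => e k *: u k) _ k kN) => s /andP[s0 sd].
  have Ss := Su s; have Ss2 := Su (s / 2).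
  have := submodZD Ssub (- 2^-1 ^+ N) (Ss _) (Ss2 _).
  rewrite s0 sd divr_gt0 ?ltr0n // => /(_ isT).
  rewrite (lt_trans _ sd) ?ltr_pdivrMr ?ltr_pMr ?ltr1n ?ltr0n // => /(_ isT).
  rewrite scaler_sumr -big_split big_ord_recr /=.
  set z := (X in _ + X); have -> : z = 0.
    by rewrite /z scalerA -scalerDl exprMn mulNr mulrC addNr scale0r.
  rewrite addr0 => SS; apply: (eq_ind _ S SS).
  apply: eq_bigr => i _; rewrite !scalerA -scalerDl; congr (_ *: _).
  by rewrite exprMn /e mulNr mulrBr addrC (mulrC (s ^+ i) (_ ^+ N)).
move=> k; rewrite ltnS leq_eqVlt => /predU1P[-> |]; last exact: SuN.
(* Once the lower coefficients lie in [S], the single value [s = d / 2] isolates the top one. *)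
have d2 : 0 < d / 2 < d.
  by rewrite divr_gt0 ?ltr0n // ltr_pdivrMr ?ltr_pMr ?ltr1n ?ltr0n.
have := Su _ d2; rewrite big_ord_recr /=.
set w := \sum_(i < N) _ => Sw; have {}Sw : S ((d / 2) ^+ N *: u N).
  rewrite -[_ *: _](addKr w); apply: (submodD Ssub) Sw.
  rewrite -scaleN1r; apply: (submodZ Ssub); apply: (submod_sum Ssub) => i _.
  by apply: (submodZ Ssub); apply: SuN.
have := submodZ Ssub ((d / 2) ^+ N)^-1 Sw.
by rewrite scalerA mulVf ?scale1r // expf_neq0 // gt_eqF //; case/andP: d2.
Qed.

(** * Surjectivity of injective endomorphisms on stable subspaces *)

Lemma linear_dependence (F : fieldType) (N : nat) (x : nat -> 'rV[F]_N) :
  exists2 c : nat -> F, (exists2 k, (k <= N)%N & c k != 0)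
    & \sum_(k < N.+1) c k *: x k = 0.
Proof.
pose M := \matrix_(i < N.+1) x i.
have : kermx M != 0.
  rewrite kermx_eq0 -row_leq_rank -ltnNge ltnS; exact: rank_leq_col.
case/rowV0Pn => v /sub_kermxP vM v0.
have [i vi] : exists i, v 0 i != 0.
  apply/existsP; apply: contraNT v0; rewrite negb_exists => /forallP v0.
  by apply/eqP/rowP => i; rewrite mxE; apply/eqP; rewrite -[_ == _]negbK v0.
exists (fun k => v 0 (inord k)); first by exists i; rewrite ?inord_val // -ltnS.
rewrite -[RHS]vM mulmx_sum_row; apply: eq_bigr => k _.
by rewrite inord_val rowK.
Qed.

(* [u] and its iterates are dependent; injectivity of [T] lets one cancel the
   lowest power of [T] occurring in a relation, which expresses [u] through
   [T u, T^2 u, ...]. *)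
Lemma submod_surj (F : fieldType) (V : lmodType F) (N : nat)
    (T : {linear V -> V}) (f : {linear V -> 'rV[F]_N}) (D S : set V) :
  injective T -> submod_closed (mem S) ->
  submod_closed (mem D) -> (forall v, D v -> f v = 0 -> v = 0) ->
  (forall v, D v -> D (T v)) -> (forall v, S v -> S (T v)) ->
  forall u, D u -> S u -> exists2 v, S v & T v = u.
Proof.
move=> Tinj Ssub Dsub finj TD TS u Du Su.
have Dk k : D (iter k T u) by elim: k => //= k; apply: TD.
have Sk k : S (iter k T u) by elim: k => //= k; apply: TS.
(* [f] embeds [D] into dimension [N], so the [N.+1] vectors [u, T u, ..., T^N u] are dependent. *)
have [c cN c0] := linear_dependence (fun k => f (iter k T u)).
have {}c0 : \sum_(k < N.+1) c k *: iter k T u = 0.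
  apply: finj.
    by apply: (submod_sum Dsub) => k _; apply: (submodZ Dsub).
  by rewrite -[RHS]c0 linear_sum; apply: eq_bigr => k _ /=; rewrite linearZ.
have cE : exists k, (k <= N)%N && (c k != 0).
  by case: cN => k kN ck; exists k; apply/andP.
case: (ex_minnP cE) => j /andP[jN cj] jmin.
have {}c0 : \sum_(k < N.+1 - j) c (j + k)%N *: iter k T u = 0.
  have Tj : injective (iter j T) by elim: {+}j => //= i ih x y /Tinj/ih.
  have Tj_lin (a : F) (x y : V) :
      iter j T (a *: x + y) = a *: iter j T x + iter j T y.
    by elim: {+}j => //= i ->; rewrite linearP.
  have Tj0 : iter j T 0 = 0 by elim: {+}j => //= i ->; rewrite linear0.
  apply: Tj; rewrite Tj0 -[RHS]c0.
  rewrite (big_morph (iter j T) (id1 := 0) (op1 := +%R)) //; last first.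
    by move=> x y; rewrite -[x]scale1r Tj_lin !scale1r.
  rewrite -[RHS](big_mkord xpredT (fun k => c k *: iter k T u)).
  rewrite (big_cat_nat (n := j)) /= ?(leqW jN) //.
  (* The terms below [j] vanish by minimality of [j]. *)
  rewrite [X in _ = X + _]big_nat [X in _ = X + _]big1 ?add0r.
    rewrite -[X in \sum_(X <= i < _) _]add0n big_addn big_mkord.
    apply: eq_bigr => k _.
    by rewrite -[X in iter j T X]addr0 Tj_lin Tj0 addr0 [(k + j)%N]addnC iterD.
  move=> k /andP[_ kj]; have [->|ck] := eqVneq (c k) 0; first by rewrite scale0r.
  have := jmin k; rewrite ck (leq_trans (ltnW kj) jN) => /(_ isT).
  by rewrite leqNgt kj.
move: c0; rewrite subSn // big_ord_recl addn0 /= => /(canRL (addrK _)).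
rewrite add0r => c0.
exists (- (c j)^-1 *: \sum_(i < N - j) c (j + bump 0 i)%N *: iter i T u).
  apply: (submodZ Ssub); apply: (submod_sum Ssub) => k _.
  exact: (submodZ Ssub).
rewrite linearZ /= raddf_sum /= scaleNr.
under eq_bigr do rewrite linearZ /=.
by rewrite -scalerN -c0 scalerA mulVf // scale1r.
Qed.

(** * Taylor expansion along a direction and its top coefficient *)

Lemma coefM_top (R : nzRingType) (p q : {poly R}) a b :
  (size p <= a.+1)%N -> (size q <= b.+1)%N ->
  (size (p * q)%R <= (a + b).+1)%N /\ (p * q)`_(a + b) = p`_a * q`_b.
Proof.
move=> pa qb; split.
  apply: leq_trans (size_polyMleq _ _) _.
  by rewrite -subn1 leq_subLR add1n -addSn -addnS leq_add.
(* In the convolution only the index [a] survives: below it the index into [q] exceeds [b], above it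
   [p] has no coefficient. *)
rewrite coefM (bigD1 (Ordinal (leq_addr b a : (a < (a + b).+1)%N))) //=.
rewrite addKn big1 ?addr0 // => i; rewrite -val_eqE /= neq_ltn => /orP[ia|ai].
  rewrite [X in _ * X]nth_default ?mulr0 // (leq_trans qb) //.
  by rewrite ltn_subRL ltn_add2r.
by rewrite nth_default ?mul0r // (leq_trans pa).
Qed.

Lemma coef_prod_top (R : comNzRingType) (I : Type) (r : seq I)
    (p : I -> {poly R}) (k : I -> nat) :
  (forall i, (size (p i) <= 2)%N) ->
  (size (\prod_(i <- r) p i ^+ k i)%R <= (\sum_(i <- r) k i).+1)%N
  /\ (\prod_(i <- r) p i ^+ k i)`_(\sum_(i <- r) k i)
     = \prod_(i <- r) (p i)`_1 ^+ k i.
Proof.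
move=> p2; elim: r => [|i r [IH1 IH2]].
  by rewrite !big_nil size_poly1 coef1.
have [X1 X2] : (size (p i ^+ k i) <= (k i).+1)%N
    /\ (p i ^+ k i)`_(k i) = (p i)`_1 ^+ k i.
  elim: (k i) => [|n [H1 H2]]; first by rewrite size_poly1 coef1.
  by have [] := coefM_top (p2 i) H1; rewrite !exprS H2.
by have [] := coefM_top X1 IH1; rewrite !big_cons X2 IH2.
Qed.

Section Taylor.
Context (R : comNzRingType) (n : nat).
Implicit Types (w : 'cV[R]_n) (Q r : {mpoly R[n]}).

(* [Q(x + t w)] as a polynomial in the variable [t]. *)
Definition taylor w Q : {poly {mpoly R[n]}} :=
  mmap (polyC \o @mpolyC n R) (fun i => ('X_i)%:P + (w i 0)%:MP *: 'X) Q.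

(** Allowing a polynomial [r] instead of a scalar gives displacements along [w] that depend on the
    point, such as [s QH(x) w]. *)
Lemma horner_taylor w Q r :
  (taylor w Q).[r] = Q \mPo [tuple 'X_i + w i 0 *: r | i < n].
Proof.
rewrite /taylor /mmap horner_sum; apply: eq_bigr => m _ /=.
rewrite hornerCM; congr (_ * _); rewrite horner_prod; apply: eq_bigr => i _.
by rewrite horner_exp tnth_mktuple !hornerE mul_mpolyC.
Qed.

Lemma size_taylor w Q : (size (taylor w Q) <= msize Q)%N.
Proof.
apply: leq_trans (size_sum _ _ _) _; apply/bigmax_leqP_seq => m mQ _ /=.
rewrite mul_polyC; apply: leq_trans (size_scale_leq _ _) _.
apply: leq_trans (msize_mdeg_lt mQ); rewrite mdegE.
apply: (coef_prod_top _ _ _).1 => i.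
rewrite (leq_trans (size_polyD _ _)) // geq_max size_polyC.
rewrite (leq_trans (leq_b1 _)) // (leq_trans (size_scale_leq _ _)) //.
by rewrite size_polyX.
Qed.

(** Only monomials of top degree reach this power of [t], and each contributes its coefficient times
    its value at [w]; hence the result is constant in [x]. *)
Lemma coef_taylor_top w Q : (taylor w Q)`_(msize Q).-1 =
  (pihomog mdeg (msize Q).-1 Q).@[fun i => w i 0]%:MP.
Proof.
rewrite /taylor /mmap coef_sum /pihomog (big_morph _ (mevalD _) (meval0 _)).
rewrite (big_morph _ (@mpolyCD n R) (@mpolyC0 n R)) [RHS]big_mkcond /=.
apply: eq_big_seq => m mQ /=; rewrite coefCM mevalZ mpolyCM.
pose p i : {poly {mpoly R[n]}} := ('X_i)%:P + (w i 0)%:MP *: 'X.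
have p2 i : (size (p i) <= 2)%N.
  rewrite (leq_trans (size_polyD _ _)) // geq_max size_polyC.
  rewrite (leq_trans (leq_b1 _)) // (leq_trans (size_scale_leq _ _)) //.
  by rewrite size_polyX.
have [p_size p_top] := coef_prod_top (index_enum _) m p2.
rewrite -mdegE in p_size p_top; case: eqP => [<-|/eqP md].
  congr (_ * _); rewrite p_top mevalX rmorph_prod; apply: eq_bigr => i _ /=.
  by rewrite rmorphXn /= /p coefD coefC add0r coefZ coefX mulr1.
rewrite nth_default ?mulr0 // (leq_trans p_size) //.
rewrite ltn_neqAle md /=; have := msize_mdeg_lt mQ.
by case: (msize Q).
Qed.

End Taylor.

(** The leading monomial has maximal degree, so it survives in the leading form. *)
Lemma pihomog_msize_neq0 (R : nzRingType) n (Q : {mpoly R[n]}) :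
  Q != 0 -> pihomog mdeg (msize Q).-1 Q != 0.
Proof.
move=> Q0; apply/eqP => /(congr1 (mcoeff (mlead Q))).
rewrite mcoeff0 /pihomog raddf_sum -big_filter /=.
rewrite (bigD1_seq (mlead Q)) ?filter_uniq ?msupp_uniq //=; last first.
  by rewrite mem_filter mlead_supp // -mlead_deg //= eqxx.
rewrite mcoeffZ mcoeffX eqxx mulr1 big1 ?addr0 => [/eqP|m mQ].
  by rewrite mleadc_eq0 (negbTE Q0).
by rewrite mcoeffZ mcoeffX (negbTE mQ) mulr0.
Qed.

(** * Polynomials as functions on column vectors *)

Section Evalp.
Context (R : realType) (m : nat).
Implicit Types (P Q : {mpoly R[m]}) (x y w : 'cV[R]_m).

Lemma evalp_col Q (v : 'I_m -> R) : evalp Q (\col_i v i) = Q.@[v].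
Proof. by apply: meval_eq => i; rewrite mxE. Qed.

(** A nonzero difference would be nonzero at some point; polynomial identities can thus be checked
    pointwise. *)
Lemma evalp_inj P Q : (forall x, evalp P x = evalp Q x) -> P = Q.
Proof.
move=> PQ; apply/eqP; rewrite -subr_eq0; apply/contraT => /meval_neq0[v].
by rewrite mevalB -!evalp_col PQ subrr eqxx.
Qed.

Lemma evalpM P Q x : evalp (P * Q) x = evalp P x * evalp Q x.
Proof. exact: mevalM. Qed.

Lemma evalpX Q k x : evalp (Q ^+ k) x = evalp Q x ^+ k.
Proof. exact: rmorphXn. Qed.

Lemma evalp_taylor w P Q x :
  evalp (taylor w Q).[P] x = evalp Q (x + evalp P x *: w).
Proof.
rewrite horner_taylor /evalp comp_mpoly_meval; apply: meval_eq => i.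
by rewrite tnth_mktuple mevalD mevalXU mevalZ !mxE mulrC.
Qed.

Lemma degree_le1_affine Q : degree_le1 Q ->
  exists (a : 'rV[R]_m) (c : R), forall x, evalp Q x = (a *m x) 0 0 + c.
Proof.
rewrite /degree_le1 /= => Q2; exists (\row_i Q@_U_(i)), (Q@_0) => x.
have QE : Q = \sum_i Q@_U_(i) *: 'X_i + (Q@_0)%:MP.
  apply/mpolyP => k; rewrite mcoeffD mcoeffC raddf_sum /=.
  under eq_bigr do rewrite mcoeffZ mcoeffX.
  have [->|k0] := eqVneq k 0%MM.
    rewrite mulr1 big1 ?add0r // => i _.
    by rewrite -mdeg_eq0 mdeg1 mulr0.
  rewrite mulr0 addr0.
  have [/eqP/mdeg1P[i /eqP ->]|k1] := eqVneq (mdeg k) 1%N.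
    rewrite (bigD1 i) //= eqxx mulr1 big1 ?addr0 // => j ji.
    by rewrite eq_mnm1 (negbTE ji) mulr0.
  rewrite memN_msupp_eq0; last first.
    apply: msize_mdeg_ge; apply: leq_trans Q2 _.
    by rewrite ltn_neqAle eq_sym k1 lt0n mdeg_eq0.
  rewrite big1 // => i _; case: eqP => [ki|_]; last exact: mulr0.
  by rewrite -ki mdeg1 eqxx in k1.
rewrite /evalp {1}QE mevalD mevalC (big_morph _ (mevalD _) (meval0 _)) mxE.
by congr (_ + _); apply: eq_bigr => i _; rewrite mevalZ mevalXU mxE.
Qed.
End Evalp.

(** * Pullbacks by affine bijections *)

Section Affine.
Context (R : realType) (m : nat).
Implicit Types (P Q : {mpoly R[m]}) (x y w : 'cV[R]_m).
Implicit Types (tau : affine_transformation R m).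

Lemma aff_surj tau y : exists x, tau x = y.
Proof.
exists (invmx (aff_lin tau) *m (y - aff_shift tau)).
by rewrite /aff_apply mulmxA mulmxV ?aff_lin_unit // mul1mx subrK.
Qed.

Lemma pullback_inj tau : injective (pullback tau).
Proof.
move=> P Q PQ; apply: evalp_inj => y; have [x <-] := aff_surj tau y.
by rewrite -!evalp_pullback PQ.
Qed.

Lemma msize_prod_le (I : Type) (r : seq I) (p : I -> {mpoly R[m]})
    (k : I -> nat) :
  (forall i, (msize (p i) <= 2)%N) ->
  (msize (\prod_(i <- r) p i ^+ k i)%R <= (\sum_(i <- r) k i).+1)%N.
Proof.
have leM (u v : {mpoly R[m]}) a b :
    (msize u <= a.+1)%N -> (msize v <= b.+1)%N ->
    (msize (u * v)%R <= (a + b).+1)%N.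
  have [->|u0] := eqVneq u 0; first by rewrite mul0r msize0.
  have [->|v0] := eqVneq v 0; first by rewrite mulr0 msize0.
  move=> ua vb; rewrite msizeM // -subn1 leq_subLR add1n -addSn -addnS.
  exact: leq_add.
move=> p2; elim: r => [|i r IH]; first by rewrite !big_nil msize1.
rewrite !big_cons; apply: (leM _ _ _ _ _ IH).
by elim: (k i) => [|j IHj]; rewrite ?msize1 // exprS; apply: (leM _ _ 1%N).
Qed.

Lemma msize_pullback tau Q : (msize (pullback tau Q) <= msize Q)%N.
Proof.
rewrite /pullback comp_mpolyE; apply: leq_trans (msize_sum _ _ _) _.
apply/bigmax_leqP_seq => k kQ _; apply: leq_trans (msizeZ_le _ _) _.
apply: leq_trans (msize_mdeg_lt kQ); rewrite mdegE; apply: msize_prod_le => i.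
rewrite tnth_mktuple; apply: leq_trans (mmeasureD_le _ _ _) _.
rewrite geq_max mmeasureC (leq_trans (leq_b1 _)) // andbT.
apply: leq_trans (msize_sum _ _ _) _; apply/bigmax_leqP_seq => j _ _.
by apply: leq_trans (msizeZ_le _ _) _; rewrite msizeX mdeg1.
Qed.

(** [Pi] may be infinite-dimensional, but pullback is injective and does not raise degrees: the
    polynomials of size at most [msize Q] form a stable space described by finitely many
    coefficients, which [f] lists. *)
Lemma canonical_surj (Pi : set {mpoly R[m]}) tau :
  submod_closed (mem Pi) -> canonical_for Pi tau ->
  forall Q, Pi Q -> exists2 P, Pi P & pullback tau P = Q.
Proof.
move=> Pi_sub can Q PiQ; pose d := msize Q.
pose T : {linear {mpoly R[m]} -> {mpoly R[m]}} := comp_mpoly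
  [tuple \sum_(j < m) aff_lin tau i j *: 'X_j + (aff_shift tau i 0)%:MP | i < m].
pose f (P : {mpoly R[m]}) : 'rV_#|{: 'X_{1..m < d}}| :=
  \row_i P@_(enum_val i : 'X_{1..m < d}).
have f_lin : linear f.
  by move=> c P P'; apply/rowP => i; rewrite !mxE mcoeffD mcoeffZ.
pose fL : {linear {mpoly R[m]} -> 'rV_#|{: 'X_{1..m < d}}|} :=
  HB.pack f (GRing.isLinear.Build _ _ _ _ f f_lin).
apply: (@submod_surj _ _ _ T fL [set P | (msize P <= d)%N] Pi) => //.
- exact: pullback_inj.
- split=> [|c u v]; rewrite !inE /= ?msize0 // => ud vd.
  apply: leq_trans (mmeasureD_le _ _ _) _.
  by rewrite geq_max vd andbT (leq_trans (msizeZ_le _ _)).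
- move=> P Pd fP; apply/mpolyP => k; rewrite mcoeff0.
  case: (ltnP (mdeg k) d) => [kd|dk]; last first.
    by rewrite memN_msupp_eq0 // msize_mdeg_ge // (leq_trans Pd).
  move/rowP/(_ (enum_rank (BMultinom kd))): fP.
  by rewrite !mxE enum_rankK.
- by move=> P /= Pd; apply: leq_trans (msize_pullback tau P) _.
- by move=> P PiP; apply: can; exists P.
- exact: leqnn.
Qed.

End Affine.

(** * Independence of the last variable, and affine maps fixing a hyperplane *)

Lemma no_last_varP (R : realType) n (Q : {mpoly R[n.+1]}) :
  (forall x t, evalp Q (x + t *: delta_mx ord_max 0) = evalp Q x) ->
  no_last_var Q.
Proof.
move=> QE.
pose q : {mpoly R[n]} :=
  Q \mPo [tuple if unlift ord_max i is Some j then 'X_j else 0 | i < n.+1].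
exists q => //; apply: evalp_inj => x.
have -> : evalp (mwiden q) x = q.@[fun i => x (widen i) 0].
  rewrite /evalp /mwiden /mmap (big_morph _ (mevalD _) (meval0 _)) [RHS]mevalE.
  apply: eq_bigr => k _ /=.
  rewrite mevalM mevalC rmorph_prod; congr (_ * _); apply: eq_bigr => i _ /=.
  by rewrite rmorphXn /= mevalXU.
(* Sliding [x] along the last axis to last coordinate [0] does not change [Q], and there [Q] agrees
   with [q], in which the last variable is set to [0]. *)
rewrite -(QE x (- x ord_max 0)) /q comp_mpoly_meval; apply: meval_eq => i.
rewrite tnth_mktuple !mxE andbT; case: unliftP => [j|] ->.
  rewrite mevalXU (_ : _ == _ = false) ?mulr0 ?addr0.
    by congr (x _ 0); apply/val_inj; rewrite /= /bump leqNgt ltn_ord.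
  by apply/negbTE; rewrite eq_sym neq_lift.
by rewrite meval0 eqxx mulr1 subrr.
Qed.

(** Sherman-Morrison formula: [B] is the inverse of this rank-one update of the identity. *)
Lemma unit_add_outer (R : realType) m (a : 'rV[R]_m) (w : 'cV[R]_m) (s : R) :
  1 + s * (a *m w) 0 0 != 0 -> 1%:M + s *: (w *m a) \in unitmx.
Proof.
set b := (a *m w) 0 0 => b0.
have aw : a *m w = b%:M by rewrite [LHS]mx11_scalar.
pose B := 1%:M - (s / (1 + s * b)) *: (w *m a).
suff /mulmx1_unit[] : (1%:M + s *: (w *m a)) *m B = 1%:M by [].
rewrite mulmxBr mulmx1 mulmxDl mul1mx -!scalemxAr -!scalemxAl.
rewrite mulmxA -(mulmxA w) aw -mulmxA mul_scalar_mx -scalemxAr !scalerA.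
rewrite -scalerDl -addrA -scalerBl; apply/eqP.
rewrite -subr_eq0 addrAC subrr add0r scaler_eq0; apply/orP; left.
by rewrite -mulrA -[X in _ - (X + _)]mulr1 -mulrDr divfK ?subrr.
Qed.

(* Every point of the hyperplane [QH = 0] is fixed by [g]. *)
Lemma hyperplane_transvection (R : realType) m (QH : {mpoly R[m]})
    (a : 'rV[R]_m) (c : R) (w : 'cV[R]_m) (s : R) :
  (forall x, evalp QH x = (a *m x) 0 0 + c) -> 1 + s * (a *m w) 0 0 != 0 ->
  exists g : affine_transformation R m, forall x, g x = x + (s * evalp QH x) *: w.
Proof.
move=> QHE sw.
exists (AffineTransformation ((s * c) *: w) (unit_add_outer sw)) => x.
rewrite /aff_apply /= mulmxDl mul1mx QHE -addrA; congr (_ + _).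
rewrite -scalemxAl -mulmxA [a *m x]mx11_scalar mul_mx_scalar scalerA -scalerDl.
by rewrite !mxE mulr1n mulrDr.
Qed.

Lemma aff_comp (R : realType) m (f g : affine_transformation R m) :
  exists h : affine_transformation R m, forall x, h x = f (g x).
Proof.
have fg_unit : aff_lin f *m aff_lin g \in unitmx.
  by rewrite unitmx_mul !aff_lin_unit.
exists (AffineTransformation (aff_lin f *m aff_shift g + aff_shift f) fg_unit).
by move=> x; rewrite /aff_apply /= mulmxDr mulmxA addrA.
Qed.

(** * Consequences of canonicity for [Pi] *)

Section Hyperplane.
Context (R : realType) (n : nat).
Context (Pi : set {mpoly R[n.+1]}) (Pi_sub : polynomial_subspace Pi).
Context (QH : {mpoly R[n.+1]}) (QH_deg : degree_le1 QH).
Hypothesis H_canonical : forall tau : affine_transformation R n.+1,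
     tau @` zero_set QH = @last_zero R n -> canonical_for Pi tau.
Context (tauH : affine_transformation R n.+1)
  (tauH_H : tauH @` zero_set QH = @last_zero R n).

Lemma taylor_coef_mem (w : 'cV[R]_n.+1) (Q : {mpoly R[n.+1]}) k :
  Pi Q -> Pi (QH ^+ k * (taylor w Q)`_k).
Proof.
move=> PiQ; have [a [c QHE]] := degree_le1_affine QH_deg.
have [sz|/(nth_default 0) ->] := ltnP k (size (taylor w Q)); last first.
  by rewrite mulr0; exact: submod0 Pi_sub.
(* For [0 < s < d] one has [s |al| < 1], so [1 + s al] is nonzero and [g] is invertible; the added
   [1] keeps [d] meaningful when [al = 0]. *)
pose al := (a *m w) 0 0; pose d := (1 + `|al|)^-1.
have al1 : 0 < 1 + `|al| by rewrite ltr_wpDr.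
have d0 : 0 < d by rewrite invr_gt0.
apply: (@submod_coef _ _ _ Pi_sub d _
  (fun k => QH ^+ k * (taylor w Q)`_k) d0 _ k sz) => {k sz} s /andP[s0 sd].
have [|g gE] := hyperplane_transvection (w := w) (s := s) QHE.
  rewrite gt_eqF // -/al -[s * al]opprK subr_gt0 -mulrN.
  have s1 : s * (1 + `|al|) < 1 by rewrite -ltr_pdivlMr // div1r.
  apply: le_lt_trans s1; rewrite ler_wpM2l ?(ltW s0) // -normrN.
  by rewrite (le_trans (ler_norm _)) // ler_wpDl.
(* Canonicity is available for [tauH \o g], not directly for [g]; hence [Q] is first written as the
   pullback of some [P] in [Pi] by [tauH]. *)
have [P PiP PQ] := canonical_surj Pi_sub (H_canonical tauH_H) PiQ.
have [h hE] := aff_comp tauH g.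
suff -> : \sum_(k < size (taylor w Q)) s ^+ k *: (QH ^+ k * (taylor w Q)`_k)
    = pullback h P.
  apply: (H_canonical (tau := h)); last by exists P.
  rewrite -tauH_H; apply: eq_imagel => x /= Qx.
  by rewrite hE gE Qx mulr0 scale0r addr0.
transitivity (taylor w Q).[s *: QH].
  rewrite horner_coef; apply: eq_bigr => k _.
  by rewrite exprZn -scalerAr mulrC.
apply: evalp_inj => x; rewrite evalp_taylor evalp_pullback hE gE.
by rewrite -PQ evalp_pullback /evalp mevalZ.
Qed.

(** Invariance along this direction becomes independence of the last variable after pullback by
    [tauH]. *)
Definition image_dir : 'cV[R]_n.+1 := aff_lin tauH *m delta_mx ord_max 0.

Lemma tauH_image_dir x t :
  tauH (x + t *: delta_mx ord_max 0) = tauH x + t *: image_dir.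
Proof. by rewrite /aff_apply mulmxDr -scalemxAr addrAC. Qed.

Lemma pullback_no_last_var Q :
  (forall y t, evalp Q (y + t *: image_dir) = evalp Q y) ->
  no_last_var (pullback tauH Q).
Proof.
by move=> Qv; apply: no_last_varP => x t; rewrite !evalp_pullback tauH_image_dir.
Qed.

Lemma pullback_mem Q : Pi Q -> Pi (pullback tauH Q).
Proof. by move=> PiQ; apply: (H_canonical tauH_H); exists Q. Qed.

End Hyperplane.

Theorem theorem2p6 (R : realType) (n : nat)
  (Pi : set {mpoly R[n.+1]}) (Pi_sub : polynomial_subspace Pi)
  (P : set 'cV[R]_n.+1) (P_fin : finite_set P) (P_nonempty : P !=set0)
  (QH : {mpoly R[n.+1]}) (QH_deg : @degree_le1 R n.+1 QH) (QH_neq0 : QH != 0)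
  (H : set 'cV[R]_n.+1) (H_hyp : is_hyperplane H) (H_def : H = zero_set QH)
  (H_canonical : forall tau : affine_transformation R n.+1,
     tau @` H = @last_zero R n -> canonical_for Pi tau)
  (tauH : affine_transformation R n.+1) (tauH_H : tauH @` H = @last_zero R n)
  (P_unis : unisolvent_rel Pi H QH tauH P) :
  unisolvent Pi P.
Proof.
move: P_unis => [unisH unisC] [Q [PiQ Q0 QP]]; subst H.
have [a [c QHE]] := degree_le1_affine QH_deg.
have mem := taylor_coef_mem Pi_sub QH_deg H_canonical tauH_H.
have Tmem := pullback_mem H_canonical tauH_H.
have Tneq0 S : S != 0 -> pullback tauH S != 0.
  apply: contra_neq => S0; apply: (@pullback_inj _ _ tauH).
  by rewrite S0 /pullback comp_mpoly0.
set v := image_dir tauH; set b := (a *m v) 0 0.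
have QHv y t : evalp QH (y + t *: v) = evalp QH y + t * b.
  rewrite !QHE mulmxDr -scalemxAr /b; set x1 := a *m y; set x2 := a *m v.
  by rewrite !mxE addrAC.
have [b0|b0] := eqVneq b 0.
  have [w Qw] := meval_neq0 (pihomog_msize_neq0 Q0).
  pose d := (msize Q).-1.
  (* The top Taylor coefficient is the value of the leading form at [w], a nonzero constant;
     dividing by it leaves [QH ^+ d] in [Pi]. *)
  have := mem (\col_i w i) Q d PiQ.
  rewrite coef_taylor_top; under meval_eq do rewrite mxE.
  rewrite mulrC mul_mpolyC => /(submodZ Pi_sub (pihomog mdeg d Q).@[w]^-1).
  rewrite scalerA mulVf // scale1r => PiQHd.
  (* Otherwise [Q] would be a nonzero constant, which cannot vanish at a point of the non-empty
     [P]. *)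
  have d0 : d != 0%N.
    apply/eqP => d0; have [p /QP] := P_nonempty; apply/eqP.
    have : (msize Q <= 1)%N by move: d0; rewrite /d; case: (msize Q) => [|[]].
    move/msize1_polyC => QE; rewrite QE /evalp mevalC.
    by apply: contra_neq Q0 => Qc; rewrite QE Qc.
  have QHd0 : QH ^+ d != 0 by rewrite expf_neq0.
  apply: unisH; exists (QH ^+ d); split.
  - split=> //; split; first exact: Tmem.
    apply: pullback_no_last_var => y t.
    by rewrite !evalpX QHv b0 mulr0 addr0.
  - exact: Tneq0.
  - by move=> p [_ /= QHp]; rewrite evalpX QHp expr0n (negbTE d0).
pose Q1 := (taylor v Q).[- b^-1 *: QH].
have evalQ1 x : evalp Q1 x = evalp Q (x - (evalp QH x / b) *: v).
  by rewrite /Q1 evalp_taylor /evalp mevalZ mulNr mulrC scaleNr.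
(* At [s = - b^-1] the underlying map is not invertible, so membership comes from the Taylor
   coefficients rather than from a pullback. *)
have PiQ1 : Pi Q1.
  rewrite /Q1 horner_coef; apply: (submod_sum Pi_sub) => k _.
  rewrite exprZn -scalerAr mulrC; apply: (submodZ Pi_sub); exact: mem.
have Q1_0 : Q1 = 0.
  apply: contrapT => /eqP Q1_0; apply: unisH; exists Q1; split.
  - split=> //; split; first exact: Tmem.
    apply: pullback_no_last_var => y t; rewrite !evalQ1 QHv; congr evalp.
    by rewrite mulrDl mulfK // scalerDl opprD addrACA subrr addr0.
  - exact: Tneq0.
  - by move=> p [Pp /= QHp]; rewrite evalQ1 QHp mul0r scale0r subr0 QP.
have QT : Q = (taylor v Q).[0].
  by apply: evalp_inj => x; rewrite evalp_taylor /evalp meval0 scale0r addr0.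
have [Q2 QE] : exists Q2, Q = QH * Q2.
  (* The expansion minus its value at [0] is a multiple of the variable; evaluated at
     [- b^-1 *: QH], this makes [Q1 - Q] a multiple of [QH], and [Q1] is zero. *)
  have : root (taylor v Q - Q%:P) 0 by rewrite /root !hornerE -QT subrr.
  case/factor_theorem => q /(congr1 (horner^~ (- b^-1 *: QH))).
  rewrite !hornerE -/Q1 Q1_0 sub0r => /(canRL opprK) ->.
  exists (b^-1 *: q.[- b^-1 *: QH]).
  by rewrite subr0 scaleNr mulrN opprK -!scalerAr mulrC.
apply: unisC; exists Q2; split.
- by rewrite /perp_space /= -QE.
- by apply: contra_neq Q0 => Q20; rewrite QE Q20 mulr0.
- move=> p [Pp /= QHp]; have := QP p Pp; rewrite QE evalpM => /eqP.
  by rewrite mulf_eq0 => /orP[] /eqP.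
Qed.
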